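(* Let $f\in\mathcal{A}_c(\mathbb{T})$ and let $g\in\mathcal{BV}(\mathbb{T})$. If $-\infty<a<b<\infty$ then $$\int_a^b\int_{-\pi}^{\pi}f(x-y)g(y)\,dy\,dx=\int_{-\pi}^{\pi}\int_a^bf(x-y)g(y)\,dx\,dy.$$
   Context: ''Periodic'' means $2\pi$-periodic. $\mathcal{B}_c(\mathbb{T})$ is the set of continuous $F:\mathbb{R}\to\mathbb{R}$ with $F(-\pi)=0$ and $F(y+2n\pi)=F(y)+nF(\pi)$ for all $y\in[-\pi,\pi)$, $n\in\mathbb{Z}$. $\mathcal{A}_c(\mathbb{T})$ is the set of Schwartz distributions $f$ on $\mathbb{R}$ such that $f=F'$ (distributional derivative) for some $F\in\mathcal{B}_c(\mathbb{T})$; this $F$ is unique and is called the primitive of $f$. The continuous primitive integral is $\int_a^bf=F(b)-F(a)$. $\mathcal{BV}(\mathbb{T})$ is the set of periodic functions $g:\mathbb{R}\to\mathbb{R}$ of finite variation over $[-\pi,\pi]$. For $f\in\mathcal{A}_c(\mathbb{T})$ with primitive $F$ and $g\in\mathcal{BV}(\mathbb{T})$, the integral of the product is $\int_{-\pi}^{\pi}fg=F(\pi)g(\pi)-\int_{-\pi}^{\pi}F\,dg$ (Riemann--Stieltjes integral). On the left-hand side, for fixed $x$, $y\mapsto f(x-y)$ is the distribution $f\circ r_x\in\mathcal{A}_c(\mathbb{T})$, $r_x(y)=x-y$ (the distributional derivative of $y\mapsto-F(x-y)$); on the right-hand side, for fixed $y$, $x\mapsto f(x-y)$ is the translate of $f$,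 with $\int_a^bf(x-y)\,dx=F(b-y)-F(a-y)$. *)

(* Defs.v *)
From Stdlib Require Import Reals Lra Lia ZArith ClassicalEpsilon.
From mathcomp Require seq.
From Coquelicot Require Import Coquelicot.
Open Scope R_scope.

Record test_fun := TestFun {
  tf_val :> R -> R;
  tf_smooth : forall (n : nat) (x : R), ex_derive_n tf_val n x;
  tf_supp : exists M : R, forall x : R, M < Rabs x -> tf_val x = 0 }.

Definition tf_cvg (phi : nat -> test_fun) (psi : test_fun) : Prop :=
  (exists M : R, forall (k : nat) (x : R), M < Rabs x -> phi k x = 0) /\
  (forall (n : nat) (eps : posreal), eventually (fun k =>
     forall x : R, Rabs (Derive_n (phi k) n x - Derive_n psi n x) < eps)).

(* Linearity is stated through the pointwise relation chi = a phi + psi, so it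
   also says that the functional only sees the values of a test function. *)
Record distribution := Distribution {
  dist_val :> test_fun -> R;
  dist_linear : forall (a : R) (phi psi chi : test_fun),
    (forall x : R, chi x = a * phi x + psi x) ->
    dist_val chi = a * dist_val phi + dist_val psi;
  dist_cont : forall (phi : nat -> test_fun) (psi : test_fun),
    tf_cvg phi psi -> is_lim_seq (fun k => dist_val (phi k)) (dist_val psi) }.

Lemma Derive_n_reflect (phi : test_fun) (x : R) (n : nat) (y : R) :
  Derive_n (fun t => phi (x - t)) n y = (-1) ^ n * Derive_n phi n (x - y).
Proof.
rewrite (Derive_n_ext _ (fun t => phi (- t + x))) by (intros t; f_equal; ring).
rewrite (Derive_n_comp_opp (fun s => phi (s + x)) n y).
- rewrite (Derive_n_comp_trans phi n (- y) x); do 2 f_equal; ring.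
- apply filter_forall; intros z k _.
  exact (ex_derive_n_comp_trans phi k z x (tf_smooth phi k (z + x))).
Qed.

Lemma reflect_smooth (phi : test_fun) (x : R) (n : nat) (y : R) :
  ex_derive_n (fun t => phi (x - t)) n y.
Proof.
apply (ex_derive_n_ext (fun t => phi (- t + x))).
- intros t; f_equal; ring.
- apply (ex_derive_n_comp_opp (fun s => phi (s + x)) n y).
  apply filter_forall; intros z k _.
  exact (ex_derive_n_comp_trans phi k z x (tf_smooth phi k (z + x))).
Qed.

Lemma reflect_supp (phi : R -> R) (x M : R) :
  (forall y, M < Rabs y -> phi y = 0) ->
  forall y, M + Rabs x < Rabs y -> phi (x - y) = 0.
Proof.
intros H y Hy; apply H.
pose proof (Rabs_triang_inv y x); rewrite Rabs_minus_sym; lra.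
Qed.

Definition tf_reflect (x : R) (phi : test_fun) : test_fun.
Proof.
refine (TestFun (fun y => phi (x - y)) (reflect_smooth phi x) _).
destruct (tf_supp phi) as [M HM].
exists (M + Rabs x); exact (reflect_supp phi x M HM).
Defined.

Lemma shift_supp (phi : R -> R) (y M : R) :
  (forall x, M < Rabs x -> phi x = 0) ->
  forall x, M + Rabs y < Rabs x -> phi (x + y) = 0.
Proof.
intros H x Hx; apply H.
pose proof (Rabs_triang_inv x (- y)) as T; rewrite Rabs_Ropp in T.
replace (x - - y) with (x + y) in T by ring; lra.
Qed.

Definition tf_shift (y : R) (phi : test_fun) : test_fun.
Proof.
refine (TestFun (fun x => phi (x + y))
  (fun n x => ex_derive_n_comp_trans phi n x y (tf_smooth phi n (x + y))) _).
destruct (tf_supp phi) as [M HM].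
exists (M + Rabs y); exact (shift_supp phi y M HM).
Defined.

Lemma tf_cvg_reflect (x : R) (phi : nat -> test_fun) (psi : test_fun) :
  tf_cvg phi psi ->
  tf_cvg (fun k => tf_reflect x (phi k)) (tf_reflect x psi).
Proof.
intros [[M HM] H]; split.
- exists (M + Rabs x); intros k; exact (reflect_supp (phi k) x M (HM k)).
- intros n eps; destruct (H n eps) as [N HN]; exists N; intros k Hk y; simpl.
  rewrite !Derive_n_reflect, <- Rmult_minus_distr_l, Rabs_mult, pow_1_abs, Rmult_1_l.
  now apply HN.
Qed.

Lemma tf_cvg_shift (y : R) (phi : nat -> test_fun) (psi : test_fun) :
  tf_cvg phi psi ->
  tf_cvg (fun k => tf_shift y (phi k)) (tf_shift y psi).
Proof.
intros [[M HM] H]; split.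
- exists (M + Rabs y); intros k; exact (shift_supp (phi k) y M (HM k)).
- intros n eps; destruct (H n eps) as [N HN]; exists N; intros k Hk x; simpl.
  rewrite (Derive_n_comp_trans (phi k)), (Derive_n_comp_trans psi); now apply HN.
Qed.

(* The composition of f with y |-> x - y, i.e. "y |-> f (x - y)". *)
Definition dist_reflect (x : R) (f : distribution) : distribution.
Proof.
refine (Distribution (fun phi => f (tf_reflect x phi)) _ _).
- intros a phi psi chi H; apply dist_linear; intros y; exact (H (x - y)).
- intros phi psi H; exact (dist_cont f _ _ (tf_cvg_reflect x phi psi H)).
Defined.

(* The translate of f by y, i.e. "x |-> f (x - y)". *)
Definition dist_translate (y : R) (f : distribution) : distribution.
Proof.
refine (Distribution (fun phi => f (tf_shift y phi)) _ _).
- intros a phi psi chi H; apply dist_linear; intros x; exact (H (x + y)).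
- intros phi psi H; exact (dist_cont f _ _ (tf_cvg_shift y phi psi H)).
Defined.

Definition dist_scale (c : R) (f : distribution) : distribution.
Proof.
refine (Distribution (fun phi => c * f phi) _ _).
- intros a phi psi chi H; rewrite (dist_linear f a phi psi chi H); ring.
- intros phi psi H; exact (is_lim_seq_scal_l _ c _ (dist_cont f phi psi H)).
Defined.

Definition is_dist_derive (F : R -> R) (f : distribution) : Prop :=
  forall phi : test_fun,
    f phi = - RInt_gen (fun t => F t * Derive phi t)
                (Rbar_locally m_infty) (Rbar_locally p_infty).

Definition BcT (F : R -> R) : Prop :=
  (forall x : R, continuous F x) /\
  F (- PI) = 0 /\
  (forall (y : R) (n : Z), - PI <= y < PI ->
     F (y + 2 * IZR n * PI) = F y + IZR n * F PI).

Definition is_primitive (F : R -> R) (f : distribution) : Prop :=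
  BcT F /\ is_dist_derive F f.

Definition AcT (f : distribution) : Prop := exists F : R -> R, is_primitive F f.

Local Ltac Rring :=
  match goal with |- @eq _ ?u ?v => change (@eq R u v) end;
  unfold minus, plus, opp, scal; simpl; unfold mult; simpl; ring.

Lemma BcT_add (F : R -> R) (y : R) (n : Z) :
  BcT F -> F (y + 2 * IZR n * PI) = F y + IZR n * F PI.
Proof.
intros [_ [_ H]].
assert (P := PI_RGT_0).
destruct (archimed ((y + PI) / (2 * PI))) as [H1 H2].
set (m := (up ((y + PI) / (2 * PI)) - 1)%Z).
assert (E : (y + PI) / (2 * PI) * (2 * PI) = y + PI) by (field; lra).
assert (Em : IZR m = IZR (up ((y + PI) / (2 * PI))) - 1)
  by (unfold m; now rewrite minus_IZR).
set (y0 := y - 2 * IZR m * PI).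
assert (Hy0 : - PI <= y0 < PI) by (unfold y0; nra).
replace y with (y0 + 2 * IZR m * PI) at 2 by (unfold y0; ring).
replace (y + 2 * IZR n * PI) with (y0 + 2 * IZR (m + n) * PI)
  by (unfold y0; rewrite plus_IZR; ring).
rewrite !H by exact Hy0; rewrite plus_IZR; ring.
Qed.

Lemma pairing_cont (F : R -> R) (phi : test_fun) :
  (forall x, continuous F x) ->
  forall x, continuous (fun t => F t * Derive phi t) x.
Proof.
intros CF x; apply (continuous_mult F (Derive phi)); [apply CF|].
exact (ex_derive_continuous (Derive phi) x (tf_smooth phi 2 x)).
Qed.

Lemma pairing_RInt (F : R -> R) (phi : test_fun) :
  (forall x, continuous F x) ->
  exists M, 0 <= M /\ (forall x, M < Rabs x -> phi x = 0) /\
    forall A B, A <= - M -> M <= B ->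
      RInt_gen (fun t => F t * Derive phi t)
        (Rbar_locally m_infty) (Rbar_locally p_infty)
      = RInt (fun t => F t * Derive phi t) A B.
Proof.
intros CF.
destruct (tf_supp phi) as [M0 HM0].
set (M := Rmax 0 M0).
assert (M_ge0 : 0 <= M) by apply Rmax_l.
assert (HM : forall x, M < Rabs x -> phi x = 0).
{ intros x Hx; apply HM0; apply Rle_lt_trans with (2 := Hx); apply Rmax_r. }
exists M; split; [exact M_ge0|split; [exact HM|]].
intros A B HA HB.
set (h := fun t => F t * Derive phi t).
assert (Ch : forall x, continuous h x) by (apply pairing_cont, CF).
assert (exh : forall u v, ex_RInt h u v).
{ intros u v; apply (ex_RInt_continuous h); intros; apply Ch. }
assert (h0 : forall x, M < Rabs x -> h x = 0).
{ intros x Hx; unfold h.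
  rewrite (Derive_ext_loc phi (fun _ => 0)); [rewrite Derive_const; ring|].
  assert (d0 : 0 < Rabs x - M) by lra.
  exists (mkposreal _ d0).
  change (forall y : R, Rabs (y - x) < Rabs x - M -> phi y = 0).
  intros y Hy; apply HM.
  pose proof (Rabs_triang_inv x (x - y)) as T.
  replace (x - (x - y)) with y in T by ring.
  rewrite (Rabs_minus_sym x y) in T; lra. }
assert (tail : forall u v, (forall t, Rmin u v < t < Rmax u v -> M < Rabs t) ->
   RInt h u v = 0).
{ intros u v H; rewrite (RInt_ext h (fun _ => 0)).
  - rewrite RInt_const; exact (Rmult_0_r (v - u)).
  - intros t Ht; apply h0, H, Ht. }
assert (outer : forall u v, u <= - M -> M <= v -> RInt h u v = RInt h (- M) M).
{ intros u v Hu Hv.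
  rewrite <- (RInt_Chasles h u (- M) v) by apply exh.
  rewrite <- (RInt_Chasles h (- M) M v) by apply exh.
  rewrite (tail u (- M)), (tail M v).
  - Rring.
  - intros t; rewrite Rmin_left, Rmax_right by lra; intros Ht.
    rewrite Rabs_pos_eq; lra.
  - intros t; rewrite Rmin_left, Rmax_right by lra; intros Ht.
    rewrite Rabs_left; lra. }
rewrite (outer A B HA HB).
apply is_RInt_gen_unique.
intros P HP.
apply (Filter_prod _ _ _ (fun u => u < - M) (fun v => M < v)).
- exists (- M); intros; assumption.
- exists M; intros; assumption.
- intros u v Hu Hv; exists (RInt h (- M) M); split.
  + rewrite <- (outer u v) by (simpl in *; lra); apply (RInt_correct h u v), exh.
  + apply locally_singleton, HP.
Qed.

Lemma is_dist_derive_plus_const (F : R -> R) (c : R) (f : distribution) :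
  (forall x, continuous F x) ->
  is_dist_derive F f -> is_dist_derive (fun t => F t + c) f.
Proof.
intros CF H phi; rewrite (H phi); f_equal.
assert (CG : forall x, continuous (fun t => F t + c) x).
{ intros x; apply (continuous_plus F (fun _ => c)); [apply CF|].
  apply continuous_const. }
destruct (pairing_RInt F phi CF) as [M1 [M1_ge0 [S1 E1]]].
destruct (pairing_RInt _ phi CG) as [M2 [M2_ge0 [S2 E2]]].
set (B := M1 + M2 + 1).
rewrite (E1 (- B) B), (E2 (- B) B) by (unfold B; lra).
assert (D : is_RInt (Derive phi) (- B) B 0).
{ replace 0 with (minus (phi B) (phi (- B))).
  - apply (is_RInt_derive phi (Derive phi)).
    + intros x _; apply Derive_correct; exact (tf_smooth phi 1 x).
    + intros x _; exact (ex_derive_continuous (Derive phi) x (tf_smooth phi 2 x)).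
  - rewrite (S1 B), (S1 (- B)).
    + Rring.
    + rewrite Rabs_Ropp, Rabs_pos_eq; unfold B; lra.
    + rewrite Rabs_pos_eq; unfold B; lra. }
symmetry; apply is_RInt_unique.
apply (is_RInt_ext (fun t => plus (F t * Derive phi t) (scal c (Derive phi t)))).
{ intros t _; Rring. }
replace (RInt (fun t => F t * Derive phi t) (- B) B)
  with (plus (RInt (fun t => F t * Derive phi t) (- B) B) (scal c 0)).
- apply (is_RInt_plus (fun t => F t * Derive phi t)); [|apply (is_RInt_scal (Derive phi)), D].
  apply (RInt_correct (fun t => F t * Derive phi t)).
  apply (ex_RInt_continuous (fun t => F t * Derive phi t)).
  intros; apply pairing_cont, CF.
- Rring.
Qed.

Lemma continuous_affine (F : R -> R) (u v : R) :
  (forall x, continuous F x) -> forall t, continuous (fun t => F (u * t + v)) t.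
Proof.
intros CF t; apply (continuous_comp (fun t => u * t + v) F); [|apply CF].
apply (ex_derive_continuous (fun t => u * t + v)); auto_derive; trivial.
Qed.

Lemma is_dist_derive_reflect (F : R -> R) (x : R) (f : distribution) :
  (forall x, continuous F x) ->
  is_dist_derive F f ->
  is_dist_derive (fun y => - F (x - y)) (dist_reflect x f).
Proof.
intros CF H phi; simpl; rewrite (H (tf_reflect x phi)); f_equal.
assert (CG : forall t, continuous (fun y => - F (x - y)) t).
{ intros t; apply (continuous_opp (fun y => F (x - y))).
  apply (continuous_ext (fun y => F (- 1 * y + x))); [intros; f_equal; ring|].
  now apply continuous_affine. }
destruct (pairing_RInt F (tf_reflect x phi) CF) as [M1 [M1_ge0 [_ E1]]].
destruct (pairing_RInt _ phi CG) as [M2 [M2_ge0 [_ E2]]].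
set (B := M1 + M2 + Rabs x).
assert (x_le := Rle_abs x); assert (x_ge := Rle_abs (- x)); rewrite Rabs_Ropp in x_ge.
rewrite (E1 (- B) B), (E2 (- 1 * B + x) (- 1 * - B + x))
  by (unfold B; lra).
rewrite <- (opp_RInt_swap (fun t => - F (x - t) * Derive phi t)).
2: { apply (ex_RInt_continuous (fun t => - F (x - t) * Derive phi t)).
     intros; now apply (pairing_cont (fun y => - F (x - y))). }
rewrite <- (RInt_comp_lin (fun t => - F (x - t) * Derive phi t) (- 1) x (- B) B).
2: { apply (ex_RInt_continuous (fun t => - F (x - t) * Derive phi t)).
     intros; now apply (pairing_cont (fun y => - F (x - y))). }
rewrite <- RInt_opp.
2: { apply (ex_RInt_continuous (fun y => scal (- 1) (- F (x - (- 1 * y + x)) * Derive phi (- 1 * y + x)))).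
     intros z _; apply (continuous_scal_r (- 1) (fun y => - F (x - (- 1 * y + x)) * Derive phi (- 1 * y + x))).
     apply (continuous_affine (fun t => - F (x - t) * Derive phi t)).
     intros; now apply (pairing_cont (fun y => - F (x - y))). }
apply RInt_ext; intros t _.
change (Derive (tf_reflect x phi) t) with (Derive_n (fun s => phi (x - s)) 1 t).
rewrite (Derive_n_reflect phi x 1 t); simpl Derive_n.
replace (x - (- 1 * t + x)) with t by ring.
replace (- 1 * t + x) with (x - t) by ring.
change (Derive (fun x => phi x)) with (Derive phi); Rring.
Qed.

Lemma is_dist_derive_translate (F : R -> R) (y : R) (f : distribution) :
  (forall x, continuous F x) ->
  is_dist_derive F f ->
  is_dist_derive (fun x => F (x - y)) (dist_translate y f).
Proof.
intros CF H phi; simpl; rewrite (H (tf_shift y phi)); f_equal.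
assert (CG : forall t, continuous (fun x => F (x - y)) t).
{ intros t; apply (continuous_ext (fun x => F (1 * x + - y))); [intros; f_equal; ring|].
  now apply continuous_affine. }
destruct (pairing_RInt F (tf_shift y phi) CF) as [M1 [M1_ge0 [_ E1]]].
destruct (pairing_RInt _ phi CG) as [M2 [M2_ge0 [_ E2]]].
set (B := M1 + M2 + Rabs y).
assert (y_le := Rle_abs y); assert (y_ge := Rle_abs (- y)); rewrite Rabs_Ropp in y_ge.
rewrite (E1 (- B) B), (E2 (1 * - B + y) (1 * B + y))
  by (unfold B; lra).
rewrite <- (RInt_comp_lin (fun t => F (t - y) * Derive phi t) 1 y (- B) B).
2: { apply (ex_RInt_continuous (fun t => F (t - y) * Derive phi t)).
     intros; now apply (pairing_cont (fun x => F (x - y))). }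
apply RInt_ext; intros t _.
change (Derive (tf_shift y phi) t) with (Derive_n (fun s => phi (s + y)) 1 t).
rewrite (Derive_n_comp_trans phi 1 t y); simpl Derive_n.
replace (1 * t + y - y) with t by ring.
replace (1 * t + y) with (t + y) by ring.
change (Derive (fun x => phi x)) with (Derive phi); Rring.
Qed.

Lemma is_dist_derive_scale (F : R -> R) (c : R) (f : distribution) :
  (forall x, continuous F x) ->
  is_dist_derive F f -> is_dist_derive (fun t => c * F t) (dist_scale c f).
Proof.
intros CF H phi; simpl; rewrite (H phi).
assert (CG : forall t, continuous (fun t => c * F t) t).
{ intros t; apply (continuous_scal_r c F), CF. }
destruct (pairing_RInt F phi CF) as [M1 [M1_ge0 [_ E1]]].
destruct (pairing_RInt _ phi CG) as [M2 [M2_ge0 [_ E2]]].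
set (B := M1 + M2).
rewrite (E1 (- B) B), (E2 (- B) B) by (unfold B; lra).
assert (E : is_RInt (fun t => c * F t * Derive phi t) (- B) B
              (scal c (RInt (fun t => F t * Derive phi t) (- B) B))).
{ apply (is_RInt_ext (fun t => scal c (F t * Derive phi t))).
  - intros t _; Rring.
  - apply (is_RInt_scal (fun t => F t * Derive phi t)).
    apply (RInt_correct (fun t => F t * Derive phi t)).
    apply (ex_RInt_continuous (fun t => F t * Derive phi t)).
    intros; now apply pairing_cont. }
rewrite (is_RInt_unique _ _ _ _ E); Rring.
Qed.

Lemma is_primitive_reflect (F : R -> R) (x : R) (f : distribution) :
  is_primitive F f ->
  is_primitive (fun y => - F (x - y) + F (x + PI)) (dist_reflect x f).
Proof.
intros [HB H]; assert (CF := proj1 HB).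
assert (CG : forall t, continuous (fun y => - F (x - y)) t).
{ intros t; apply (continuous_opp (fun y => F (x - y))).
  apply (continuous_ext (fun y => F (- 1 * y + x))); [intros; f_equal; ring|].
  now apply continuous_affine. }
split; [split; [|split]|].
- intros t; apply (continuous_plus (fun y => - F (x - y)) (fun _ => F (x + PI))).
  + apply CG.
  + apply continuous_const.
- replace (x - - PI) with (x + PI) by ring; ring.
- intros y n _.
  replace (x - (y + 2 * IZR n * PI)) with (x - y + 2 * IZR (- n) * PI)
    by (rewrite opp_IZR; ring).
  replace (x + PI) with (x - PI + 2 * IZR 1 * PI) by ring.
  rewrite !BcT_add by exact HB; rewrite opp_IZR; ring.
- apply (is_dist_derive_plus_const (fun y => - F (x - y))); [exact CG|].
  now apply is_dist_derive_reflect.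
Qed.

Lemma is_primitive_translate (F : R -> R) (y : R) (f : distribution) :
  is_primitive F f ->
  is_primitive (fun x => F (x - y) + - F (- PI - y)) (dist_translate y f).
Proof.
intros [HB H]; assert (CF := proj1 HB).
assert (CG : forall t, continuous (fun x => F (x - y)) t).
{ intros t; apply (continuous_ext (fun x => F (1 * x + - y))); [intros; f_equal; ring|].
  now apply continuous_affine. }
split; [split; [|split]|].
- intros t; apply (continuous_plus (fun x => F (x - y)) (fun _ => - F (- PI - y))).
  + apply CG.
  + apply continuous_const.
- ring.
- intros x n _.
  replace (x + 2 * IZR n * PI - y) with (x - y + 2 * IZR n * PI) by ring.
  replace (PI - y) with (- PI - y + 2 * IZR 1 * PI) by ring.
  rewrite !BcT_add by exact HB; ring.
- apply (is_dist_derive_plus_const (fun x => F (x - y))); [exact CG|].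
  now apply is_dist_derive_translate.
Qed.

Lemma is_primitive_scale (F : R -> R) (c : R) (f : distribution) :
  is_primitive F f -> is_primitive (fun t => c * F t) (dist_scale c f).
Proof.
intros [HB H]; assert (CF := proj1 HB).
split; [split; [|split]|].
- intros t; apply (continuous_scal_r c F), CF.
- rewrite (proj1 (proj2 HB)); ring.
- intros y n _; rewrite BcT_add by exact HB; ring.
- now apply is_dist_derive_scale.
Qed.

Lemma AcT_reflect (x : R) (f : distribution) : AcT f -> AcT (dist_reflect x f).
Proof. intros [F HF]; eexists; exact (is_primitive_reflect F x f HF). Qed.

Lemma AcT_translate (y : R) (f : distribution) : AcT f -> AcT (dist_translate y f).
Proof. intros [F HF]; eexists; exact (is_primitive_translate F y f HF). Qed.

Lemma AcT_scale (c : R) (f : distribution) : AcT f -> AcT (dist_scale c f).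
Proof. intros [F HF]; eexists; exact (is_primitive_scale F c f HF). Qed.

(* Meaningful for f in AcT; the value outside AcT is arbitrary. *)
Definition dist_primitive (f : distribution) : R -> R :=
  epsilon (inhabits (fun _ => 0)) (fun F => is_primitive F f).

Definition cp_int (f : distribution) (a b : R) : R :=
  dist_primitive f b - dist_primitive f a.

Definition finite_variation (g : R -> R) (a b : R) : Prop :=
  exists V : R, forall (n : nat) (x : nat -> R),
    x 0%nat = a -> x (S n) = b ->
    (forall i : nat, (i <= n)%nat -> x i <= x (S i)) ->
    sum_n (fun i => Rabs (g (x (S i)) - g (x i))) n <= V.

Definition BVT (g : R -> R) : Prop :=
  (forall x : R, g (x + 2 * PI) = g x) /\ finite_variation g (- PI) PI.

(* Riemann-Stieltjes integral of F with respect to g: same tagged subdivisions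
   and same filter as Coquelicot's is_RInt, which is the case g = id. *)
Definition RS_sum (F g : R -> R) (ptd : @SF_seq R) : R :=
  seq.foldr Rplus 0
    (seq.pairmap (fun p q => (g (fst q) - g (fst p)) * F (snd q))
       (SF_h ptd, 0) (SF_t ptd)).

Definition is_RSInt (F g : R -> R) (a b l : R) : Prop :=
  filterlim (fun ptd => sign (b - a) * RS_sum F g ptd)
    (Riemann_fine a b) (locally l).

Definition ex_RSInt (F g : R -> R) (a b : R) : Prop :=
  exists l : R, is_RSInt F g a b l.

Definition RSInt (F g : R -> R) (a b : R) : R := iota (is_RSInt F g a b).

(* The integral over [-PI, PI] of the product f g, defined by parts. *)
Definition prod_int (f : distribution) (g : R -> R) : R :=
  dist_primitive f PI * g PI - RSInt (dist_primitive f) g (- PI) PI.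

(* Main.v *)
Require Import Defs.
From Stdlib Require Import Reals Lra Lia FunctionalExtensionality ClassicalEpsilon.
From mathcomp Require seq.
From Coquelicot Require Import Coquelicot.
Open Scope R_scope.

(** Let [F] be the primitive of [f], and [Phi] a primitive of [F].

    A continuous primitive of a distribution is unique up to a constant
    ([is_primitive_unique]), so the chosen primitives of the reflected and
    translated distributions are the explicit ones.  As [g] takes the same value
    at [- PI] and [PI], the inner integrals become
      inner left, at x  : (F (x + PI) - F (x - PI)) * g PI + k x,
                          with k x = RSInt (fun y => F (x - y)) g (- PI) PI;
      inner right, at y : g y * (F (b - y) - F (a - y)).

    Left side: [K x = RSInt (fun y => Phi (x - y)) g (- PI) PI] has derivative
    [k x] ([is_derive_RSInt_convolution]), and [k] is continuous, so that the
    integral over [a, b] is the increment of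
    (Phi (x + PI) - Phi (x - PI)) * g PI + K x.

    Right side: [F (b - y) - F (a - y)] is the derivative in [y] of
    [Phi (a - y) - Phi (b - y)].  Integration by parts ([is_RInt_by_parts])
    turns the integral into boundary terms minus the Riemann-Stieltjes integral
    of that function, which is [K a - K b]; the boundary terms are the
    increment of (Phi (x + PI) - Phi (x - PI)) * g PI.  Both sides agree.

    Two pieces of theory carry this.  For Riemann-Stieltjes integrals, a
    function of bounded variation is dominated by a monotone [V] in the sense of
    [var_dominated], and a bound on each cell of a subdivision by an increment of
    [V] sums up by telescoping.  This gives existence for continuous integrands
    ([ex_RSInt_continuous]), the estimate by the supremum norm
    ([is_RSInt_bound]) and integration by parts.  For uniqueness of primitives,
    test functions are built from exp (- 1 / x). *)

(** * Moduli of continuity and mean values *)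

Lemma uniform_modulus (F : R -> R) (a b eps : R) :
  (forall x, continuous F x) -> 0 < eps ->
  exists d, 0 < d /\ forall x y, a <= x <= b -> a <= y <= b ->
    Rabs (x - y) < d -> Rabs (F x - F y) < eps.
Proof.
intros CF He.
destruct (unifcont_1d F a b (fun x _ => CF x) (mkposreal eps He)) as [d Hd].
exists d; split; [apply cond_pos|]; intros x y Hx Hy Hxy.
destruct (Rlt_dec (Rabs (F x - F y)) eps) as [H|H]; [exact H|].
exfalso; apply (Hd x y Hx Hy).
- change (Rabs (y - x) < d); now rewrite Rabs_minus_sym.
- intros K; apply H; change (Rabs (F y - F x) < eps) in K.
  now rewrite Rabs_minus_sym.
Qed.

Lemma mean_value (F f : R -> R) (u v : R) :
  (forall x, is_derive F x (f x)) ->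
  exists c, Rmin u v <= c <= Rmax u v /\ F v - F u = f c * (v - u).
Proof.
intros D; apply (MVT_gen F u v f).
- intros x _; apply D.
- intros x _; apply continuity_pt_filterlim.
  apply (ex_derive_continuous F x); exists (f x); apply D.
Qed.

(** * Functions of bounded variation *)

(** All that the estimates use of the total variation of [g]: bounds on single
    cells by increments of one function [V] add up to [V b - V a].  Such a [V] is
    nondecreasing. *)
Definition var_dominated (V g : R -> R) (a b : R) : Prop :=
  forall x y, a <= x -> x <= y -> y <= b -> Rabs (g y - g x) <= V y - V x.

Definition variation_sum (g : R -> R) (a x s : R) : Prop :=
  exists (n : nat) (u : nat -> R),
    u 0%nat = a /\ u (S n) = x /\
    (forall i : nat, (i <= n)%nat -> u i <= u (S i)) /\
    s = sum_n (fun i => Rabs (g (u (S i)) - g (u i))) n.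

(** Adding one division point is what makes the variation over [a, x]
    superadditive in [x]; with [y = b] it also bounds these sums. *)
Lemma variation_sum_extend (g : R -> R) (a x y s : R) :
  x <= y -> variation_sum g a x s ->
  variation_sum g a y (s + Rabs (g y - g x)).
Proof.
intros Hxy [n [u [H0 [H1 [H2 ->]]]]].
set (w := fun i => if Nat.leb i (S n) then u i else y).
assert (Ew : forall i, (i <= S n)%nat -> w i = u i).
{ intros i Hi; unfold w; now rewrite (proj2 (Nat.leb_le i (S n)) Hi). }
assert (Ey : w (S (S n)) = y).
{ unfold w; now rewrite (proj2 (Nat.leb_gt (S (S n)) (S n)) (Nat.lt_succ_diag_r _)). }
exists (S n), w; split; [|split; [|split]].
- rewrite Ew by lia; exact H0.
- exact Ey.
- intros i Hi; destruct (Nat.eq_dec i (S n)) as [->|Hn].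
  + rewrite Ey, Ew, H1 by lia; exact Hxy.
  + rewrite !Ew by lia; apply H2; lia.
- rewrite sum_Sn, Ey, Ew, H1 by lia.
  change plus with Rplus; f_equal.
  apply sum_n_ext_loc; intros i Hi; rewrite !Ew by lia; reflexivity.
Qed.

(** The dominating function is the variation of [g] over [a, x]. *)
Lemma finite_variation_dominated (g : R -> R) (a b : R) :
  finite_variation g a b -> exists V, var_dominated V g a b.
Proof.
intros [V HV].
exists (fun x => real (Lub_Rbar (variation_sum g a x))).
assert (ne : forall x, a <= x -> variation_sum g a x (Rabs (g x - g a))).
{ intros x Hx; exists 0%nat, (fun i => match i with O => a | _ => x end).
  repeat split.
  - intros i Hi; replace i with 0%nat by lia; exact Hx.
  - now rewrite sum_O. }
assert (bd : forall x s, x <= b -> variation_sum g a x s -> s <= V).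
{ intros x s Hx Hs; destruct (variation_sum_extend g a x b s Hx Hs)
    as [n [u [H0 [H1 [H2 E]]]]].
  assert (K := HV n u H0 H1 H2); rewrite <- E in K.
  pose proof (Rabs_pos (g b - g x)); lra. }
assert (lub : forall x, a <= x <= b ->
  is_lub_Rbar (variation_sum g a x) (Finite (real (Lub_Rbar (variation_sum g a x))))).
{ intros x Hx; pose proof (Lub_Rbar_correct (variation_sum g a x)) as L.
  destruct (Lub_Rbar (variation_sum g a x)) as [r| |]; [exact L| |]; exfalso.
  - exact (proj2 L (Finite V) (fun s Hs => bd x s (proj2 Hx) Hs)).
  - exact (proj1 L _ (ne x (proj1 Hx))). }
intros x y Hx Hxy Hy.
assert (K : Rbar_le (Finite (real (Lub_Rbar (variation_sum g a x))))
  (Finite (real (Lub_Rbar (variation_sum g a y)) - Rabs (g y - g x)))).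
{ apply (lub x); [lra|]; intros s Hs; simpl.
  assert (T := proj1 (lub y (conj (Rle_trans _ _ _ Hx Hxy) Hy)) _
                 (variation_sum_extend g a x y s Hxy Hs)).
  simpl in T; lra. }
simpl in K; lra.
Qed.

(** * Sums over the cells of a tagged subdivision *)

(** A subdivision starting at [c] is the list of its pairs (right end, tag), and
    [D u v t] is the contribution of the cell [u, v] with tag [t].  Riemann sums,
    Riemann-Stieltjes sums, telescoping sums and error terms are all of this
    form. *)
Fixpoint cell_sum (D : R -> R -> R -> R) (c : R) (l : list (R * R)) : R :=
  match l with
  | nil => 0
  | cons (v, t) l' => D c v t + cell_sum D v l'
  end.

Lemma RS_sum_cells (F g : R -> R) (p : @SF_seq R) :
  RS_sum F g p = cell_sum (fun u v t => (g v - g u) * F t) (SF_h p) (SF_t p).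
Proof.
destruct p as [c l]; unfold RS_sum; simpl.
assert (E : forall z, seq.foldr Rplus 0 (seq.pairmap
  (fun p q => (g (fst q) - g (fst p)) * F (snd q)) (c, z) l)
  = cell_sum (fun u v t => (g v - g u) * F t) c l); [|apply E].
revert c.
induction l as [|[v t] l IH]; intros c z; simpl; [reflexivity|].
now rewrite IH.
Qed.

Lemma Riemann_sum_cells (f : R -> R) (p : @SF_seq R) :
  Riemann_sum f p = cell_sum (fun u v t => (v - u) * f t) (SF_h p) (SF_t p).
Proof.
destruct p as [c l]; unfold Riemann_sum; simpl.
assert (E : forall z, seq.foldr Rplus 0 (seq.pairmap
  (fun p q => (fst q - fst p) * f (snd q)) (c, z) l)
  = cell_sum (fun u v t => (v - u) * f t) c l); [|apply E].
revert c; induction l as [|[v t] l IH]; intros c z; simpl; [reflexivity|].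
now rewrite IH.
Qed.

Lemma cell_sum_linear (k : R) (D1 D2 D : R -> R -> R -> R) (c : R) l :
  (forall u v t, D u v t = D1 u v t + k * D2 u v t) ->
  cell_sum D c l = cell_sum D1 c l + k * cell_sum D2 c l.
Proof.
intros E; revert c; induction l as [|[v t] l IH]; intros c; simpl; [ring|].
rewrite E, IH; ring.
Qed.

Inductive fine_cells (a b eta : R) : R -> list (R * R) -> Prop :=
| fine_nil : fine_cells a b eta b nil
| fine_cons c v t l :
    a <= c -> c <= t <= v -> v - c <= eta ->
    fine_cells a b eta v l -> fine_cells a b eta c (cons (v, t) l).

Lemma fine_cells_le_end (a b eta c : R) l : fine_cells a b eta c l -> c <= b.
Proof. induction 1; lra. Qed.

Lemma cell_sum_bound (D : R -> R -> R -> R) (W : R -> R) (a b eta : R) :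
  (forall u v t, a <= u -> u <= t <= v -> v <= b -> v - u <= eta ->
     Rabs (D u v t) <= W v - W u) ->
  forall c l, fine_cells a b eta c l -> Rabs (cell_sum D c l) <= W b - W c.
Proof.
intros HD c l H; induction H as [|c v t l Hc Ht Hv Hl IH]; simpl.
- rewrite Rabs_R0; lra.
- assert (Hb := fine_cells_le_end _ _ _ _ _ Hl).
  assert (K := HD c v t Hc Ht Hb Hv).
  pose proof (Rabs_triang (D c v t) (cell_sum D v l)); lra.
Qed.

Lemma cell_sum_telescope (a b eta : R) (h : R -> R) c l :
  fine_cells a b eta c l -> cell_sum (fun u v _ => h v - h u) c l = h b - h c.
Proof. induction 1 as [|c v t l _ _ _ _ IH]; simpl; [|rewrite IH]; ring. Qed.

(** The list that remains when a fine subdivision has been read up to the point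
    [c]: the first cell may have started before [c], and its tag may lie to the
    left of [c]. *)
Definition part_consumed (a b eta c : R) (l : list (R * R)) : Prop :=
  exists c0, c0 <= c /\ fine_cells a b eta c0 l /\
    match l with nil => c = b | cons (v, _) _ => c <= v end.

Lemma fine_part_consumed (a b eta c : R) l :
  fine_cells a b eta c l -> part_consumed a b eta c l.
Proof.
intros H; exists c; split; [lra|split; [exact H|]].
inversion H; subst; lra.
Qed.

Lemma part_consumed_cons (a b eta c v t : R) l :
  part_consumed a b eta c (cons (v, t) l) ->
  c <= v <= b /\ a <= t <= b /\ v - eta <= t <= v /\ v - eta <= c /\
  part_consumed a b eta v l /\
  forall d, c <= d <= v -> part_consumed a b eta d (cons (v, t) l).
Proof.
intros [c0 [H0 [H Hv]]]; inversion H; subst.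
assert (v <= b) by (eapply fine_cells_le_end; eassumption).
repeat split; try lra.
- now apply fine_part_consumed.
- intros d Hd; exists c0; repeat split; try lra; assumption.
Qed.

(** Only degenerate cells can remain at [b]. *)
Lemma exhausted_sum (a b eta : R) (F g : R -> R) l :
  part_consumed a b eta b l ->
  cell_sum (fun u v t => (g v - g u) * F t) b l = 0.
Proof.
induction l as [|[v t] l IH]; intros H; simpl; [reflexivity|].
apply part_consumed_cons in H; destruct H as [Hv [_ [_ [_ [Hl _]]]]].
assert (v = b) by lra; subst v; rewrite IH by exact Hl; ring.
Qed.

(** The Cauchy estimate, by merging the two subdivisions as sorted lists.  Both
    are read up to the same point [c] and advance together to the nearest of
    their next division points; the cell that ends later is cut there and
    keeps its tag.  Each step adds the difference of the two integrands
    at tags of cells that both contain [c], hence at distance at most [2 * eta],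
    times one increment of [g].  No common refinement has to be built. *)
Lemma cell_sum_compare (V F g : R -> R) (a b eta eps : R) :
  var_dominated V g a b ->
  (forall s t, a <= s <= b -> a <= t <= b -> Rabs (s - t) <= 2 * eta ->
     Rabs (F s - F t) <= eps) ->
  forall c p q, a <= c ->
    part_consumed a b eta c p -> part_consumed a b eta c q ->
    Rabs (cell_sum (fun u v t => (g v - g u) * F t) c p
          - cell_sum (fun u v t => (g v - g u) * F t) c q) <= eps * (V b - V c).
Proof.
intros HV HF.
set (D := fun u v t => (g v - g u) * F t).
assert (ind : forall n c p q, (length p + length q <= n)%nat -> a <= c ->
  part_consumed a b eta c p -> part_consumed a b eta c q ->
  Rabs (cell_sum D c p - cell_sum D c q) <= eps * (V b - V c)).
2: { intros c p q; apply (ind _ c p q (le_n _)). }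
induction n as [|n IH]; intros c p q Hn Hc Hp Hq.
{ destruct p, q; simpl in Hn; try lia.
  destruct Hp as [_ [_ [_ ->]]]; simpl; rewrite Rminus_diag, Rabs_R0; lra. }
destruct p as [|[x t] p].
{ destruct Hp as [_ [_ [_ ->]]]; unfold D; rewrite (exhausted_sum a _ eta F g q Hq).
  simpl; rewrite Rminus_diag, Rabs_R0; lra. }
destruct q as [|[y s] q].
{ destruct Hq as [_ [_ [_ ->]]]; unfold D.
  rewrite (exhausted_sum a _ eta F g _ Hp).
  simpl; rewrite Rminus_diag, Rabs_R0; lra. }
destruct (part_consumed_cons _ _ _ _ _ _ _ Hp) as [p1 [p2 [p3 [p4 [p5 p6]]]]].
destruct (part_consumed_cons _ _ _ _ _ _ _ Hq) as [q1 [q2 [q3 [q4 [q5 q6]]]]].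
simpl in Hn.
assert (step : forall z rp rq, c <= z -> z <= b -> z <= x -> z <= y ->
  cell_sum D c (cons (x, t) p) = D c z t + cell_sum D z rp ->
  cell_sum D c (cons (y, s) q) = D c z s + cell_sum D z rq ->
  (length rp + length rq <= n)%nat ->
  part_consumed a b eta z rp -> part_consumed a b eta z rq ->
  Rabs (cell_sum D c (cons (x, t) p) - cell_sum D c (cons (y, s) q))
    <= eps * (V b - V c)).
{ intros z rp rq Hz Hb Hx Hy Ep Eq Hl Fp Fq; rewrite Ep, Eq.
  assert (K := IH z rp rq Hl (Rle_trans _ _ _ Hc Hz) Fp Fq).
  assert (G := HV c z Hc Hz Hb).
  assert (T : Rabs (F t - F s) <= eps).
  { apply HF; [lra|lra|apply Rabs_le; lra]. }
  replace (D c z t + cell_sum D z rp - (D c z s + cell_sum D z rq))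
    with ((g z - g c) * (F t - F s) + (cell_sum D z rp - cell_sum D z rq))
    by (unfold D; ring).
  apply Rle_trans with (1 := Rabs_triang _ _); rewrite Rabs_mult.
  pose proof (Rabs_pos (g z - g c)); pose proof (Rabs_pos (F t - F s)); nra. }
destruct (Rle_dec x y) as [Hxy|Hxy].
- apply (step x p (cons (y, s) q)); try lra; try lia.
  + reflexivity.
  + simpl; unfold D; ring.
  + simpl; lia.
  + exact p5.
  + apply q6; lra.
- apply (step y (cons (x, t) p) q); try lra.
  + simpl; unfold D; ring.
  + reflexivity.
  + simpl; lia.
  + apply p6; lra.
  + exact q5.
Qed.

Lemma pointed_fine_cells (a b eta : R) (p : @SF_seq R) :
  pointed_subdiv p -> a <= SF_h p -> seq.last (SF_h p) (SF_lx p) = b ->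
  seq_step (SF_lx p) < eta -> fine_cells a b eta (SF_h p) (SF_t p).
Proof.
induction p as [c|[c t] s IH] using (@SF_cons_ind R); intros Hp Ha Hl Hs.
- simpl in Hl; subst b; constructor.
- assert (Hc := Hp 0%nat (Nat.lt_0_succ _)).
  simpl in Ha, Hl, Hs, Hc |- *.
  unfold seq_step in Hs; simpl in Hs.
  assert (Hs1 := Rle_lt_trans _ _ _ (Rmax_l _ _) Hs).
  assert (Hs2 := Rle_lt_trans _ _ _ (Rmax_r _ _) Hs).
  assert (Hd := Rle_abs (SF_h s - c)).
  constructor; try lra.
  apply IH; [exact (ptd_cons _ _ Hp)|lra|exact Hl|exact Hs2].
Qed.

Lemma Riemann_fine_cells (a b eta : R) :
  a <= b -> 0 < eta ->
  Riemann_fine a b (fun p => SF_h p = a /\ fine_cells a b eta a (SF_t p)).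
Proof.
intros Hab He; exists (mkposreal eta He); intros p Hs [Hp [Hh Hl]].
rewrite Rmin_left in Hh by exact Hab; rewrite Rmax_right in Hl by exact Hab.
split; [exact Hh|]; rewrite <- Hh at 2.
apply pointed_fine_cells; [exact Hp|lra|exact Hl|exact Hs].
Qed.

(** * The Riemann-Stieltjes integral of a continuous function *)

Lemma is_RSInt_intro (F g : R -> R) (a b l : R) :
  a < b ->
  (forall eps, 0 < eps -> Riemann_fine a b (fun p =>
     Rabs (cell_sum (fun u v t => (g v - g u) * F t) (SF_h p) (SF_t p) - l) < eps)) ->
  is_RSInt F g a b l.
Proof.
intros Hab H; apply filterlim_locally; intros eps.
apply filter_imp with (2 := H eps (cond_pos eps)); intros p Hp.
rewrite sign_eq_1, Rmult_1_l, RS_sum_cells by lra; exact Hp.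
Qed.

Lemma is_RSInt_elim (F g : R -> R) (a b l eps : R) :
  a < b -> is_RSInt F g a b l -> 0 < eps ->
  Riemann_fine a b (fun p =>
     Rabs (cell_sum (fun u v t => (g v - g u) * F t) (SF_h p) (SF_t p) - l) < eps).
Proof.
intros Hab H He.
apply filter_imp with (2 := proj1 (filterlim_locally _ _) H (mkposreal eps He)).
intros p Hp; rewrite sign_eq_1, Rmult_1_l, RS_sum_cells in Hp by lra; exact Hp.
Qed.

Lemma RSInt_unique (F g : R -> R) (a b l : R) :
  is_RSInt F g a b l -> RSInt F g a b = l.
Proof. apply (iota_filterlim_locally (V := R_CompleteNormedModule)). Qed.

Lemma is_RSInt_RSInt (F g : R -> R) (a b : R) :
  ex_RSInt F g a b -> is_RSInt F g a b (RSInt F g a b).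
Proof. intros [l Hl]; now rewrite (RSInt_unique _ _ _ _ _ Hl). Qed.

Lemma is_RSInt_linear (F1 F2 F g : R -> R) (k a b l1 l2 : R) :
  a < b -> (forall x, F x = F1 x + k * F2 x) ->
  is_RSInt F1 g a b l1 -> is_RSInt F2 g a b l2 ->
  is_RSInt F g a b (l1 + k * l2).
Proof.
intros Hab E H1 H2; apply is_RSInt_intro; [exact Hab|]; intros eps He.
pose proof (Rabs_pos k) as Hk.
assert (He2 : 0 < eps / 2 / (Rabs k + 1)) by (apply Rdiv_lt_0_compat; lra).
assert (Q1 := is_RSInt_elim _ _ _ _ _ (eps / 2) Hab H1 ltac:(lra)).
assert (Q2 := is_RSInt_elim _ _ _ _ _ _ Hab H2 He2).
apply filter_imp with (2 := filter_and _ _ Q1 Q2); clear Q1 Q2.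
intros p [Q1 Q2].
rewrite (cell_sum_linear k (fun u v t => (g v - g u) * F1 t)
           (fun u v t => (g v - g u) * F2 t)) by (intros; rewrite E; ring).
set (S1 := cell_sum (fun u v t => (g v - g u) * F1 t) _ _) in *.
set (S2 := cell_sum (fun u v t => (g v - g u) * F2 t) _ _) in *.
replace (S1 + k * S2 - (l1 + k * l2)) with (S1 - l1 + k * (S2 - l2)) by ring.
apply Rle_lt_trans with (1 := Rabs_triang _ _); rewrite Rabs_mult.
assert (B : Rabs k * Rabs (S2 - l2) <= eps / 2).
{ replace (eps / 2) with ((Rabs k + 1) * (eps / 2 / (Rabs k + 1))) by (field; lra).
  apply Rmult_le_compat; try apply Rabs_pos; lra. }
lra.
Qed.

Lemma is_RSInt_const (k : R) (g : R -> R) (a b : R) :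
  a < b -> is_RSInt (fun _ => k) g a b (k * (g b - g a)).
Proof.
intros Hab; apply is_RSInt_intro; [exact Hab|]; intros eps He.
apply filter_imp with (2 := Riemann_fine_cells a b 1 (Rlt_le _ _ Hab) Rlt_0_1).
intros p [-> Hp].
rewrite (cell_sum_linear k (fun _ _ _ => 0) (fun u v _ => g v - g u))
  by (intros; ring).
rewrite (cell_sum_telescope a b 1 g) by exact Hp.
assert (Z := cell_sum_bound (fun _ _ _ => 0) (fun _ => 0) a b 1
  ltac:(intros; cbv beta; rewrite Rabs_R0; lra) a (SF_t p) Hp).
apply Rabs_le_between in Z.
apply Rabs_def1; lra.
Qed.

Lemma is_RSInt_bound (V F g : R -> R) (a b l M : R) :
  a < b -> var_dominated V g a b ->
  (forall x, a <= x <= b -> Rabs (F x) <= M) ->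
  is_RSInt F g a b l -> Rabs l <= M * (V b - V a).
Proof.
intros Hab HV HM H.
apply le_epsilon; intros eps He.
assert (Q := is_RSInt_elim _ _ _ _ _ eps Hab H He).
assert (Q2 := Riemann_fine_cells a b 1 (Rlt_le _ _ Hab) Rlt_0_1).
destruct (filter_ex _ (filter_and _ _ Q Q2)) as [p [Hp [Ea Fp]]].
rewrite Ea in Hp.
assert (B := cell_sum_bound (fun u v t => (g v - g u) * F t) (fun x => M * V x) a b 1).
assert (K : Rabs (cell_sum (fun u v t => (g v - g u) * F t) a (SF_t p))
            <= M * V b - M * V a).
{ apply B; [|exact Fp]; intros u v t Hu Ht Hv _.
  assert (G := HV u v Hu ltac:(lra) Hv); rewrite Rabs_mult.
  assert (T := HM t ltac:(lra)).
  pose proof (Rabs_pos (g v - g u)); pose proof (Rabs_pos (F t)); nra. }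
set (S := cell_sum _ _ _) in *.
replace l with (S - (S - l)) by ring.
pose proof (Rabs_triang S (- (S - l))) as T; rewrite Rabs_Ropp in T.
unfold Rminus at 1; lra.
Qed.

Lemma ex_RSInt_continuous (V F g : R -> R) (a b : R) :
  a < b -> var_dominated V g a b -> (forall x, continuous F x) ->
  ex_RSInt F g a b.
Proof.
intros Hab HV CF.
apply (filterlim_locally_cauchy (U := R_CompleteSpace)); intros eps.
assert (HVab := HV a b (Rle_refl a) (Rlt_le _ _ Hab) (Rle_refl b)).
assert (V0 : 0 <= V b - V a) by (pose proof (Rabs_pos (g b - g a)); lra).
set (e := eps / (V b - V a + 1)).
assert (He : 0 < e) by (apply Rdiv_lt_0_compat; [apply cond_pos|lra]).
destruct (uniform_modulus F a b e CF He) as [d [Hd Hm]].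
(* tags of overlapping cells of mesh d / 4 are at most d / 2 < d apart *)
exists (fun p => SF_h p = a /\ fine_cells a b (d / 4) a (SF_t p)); split.
- apply Riemann_fine_cells; lra.
- intros p q [Ep Fp] [Eq Fq].
  rewrite sign_eq_1, !Rmult_1_l, !RS_sum_cells, Ep, Eq by lra.
  set (D := fun u v t => (g v - g u) * F t).
  change (Rabs (cell_sum D a (SF_t q) - cell_sum D a (SF_t p)) < eps).
  apply Rle_lt_trans with (e * (V b - V a)).
  + apply (cell_sum_compare V F g a b (d / 4) e); [exact HV| |lra| |].
    * intros s t Hs Ht Hst; apply Rlt_le, Hm; lra.
    * now apply fine_part_consumed.
    * now apply fine_part_consumed.
  + replace (pos eps) with (e * (V b - V a + 1)) by (unfold e; field; lra); nra.
Qed.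

(** Integration by parts for the pair of a function [g] of bounded variation and
    a continuously differentiable [Psi].  The two integrals are compared along
    the same tagged subdivisions: on a cell [u, v] with tag [t], the increment of
    [g * Psi] equals
      g t * (Psi v - Psi u) + Psi t * (g v - g u)
    up to products of an increment of [g] and one of [Psi], and [Psi v - Psi u]
    is close to [C t * (v - u)].  In particular [g * C] is Riemann integrable. *)
Lemma is_RInt_by_parts (V g Psi C : R -> R) (a b L : R) :
  a < b -> var_dominated V g a b ->
  (forall x, is_derive Psi x (C x)) -> (forall x, continuous C x) ->
  is_RSInt Psi g a b L ->
  is_RInt (fun y => g y * C y) a b (g b * Psi b - g a * Psi a - L).
Proof.
intros Hab HV DPsi CC HL.
assert (CPsi : forall x, continuous Psi x)
  by (intros x; apply (ex_derive_continuous Psi x); exists (C x); apply DPsi).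
assert (HVab := HV a b (Rle_refl a) (Rlt_le _ _ Hab) (Rle_refl b)).
assert (V0 : 0 <= V b - V a) by (pose proof (Rabs_pos (g b - g a)); lra).
(* a bound for g on [a, b] *)
set (M := Rabs (g a) + (V b - V a)).
assert (M0 : 0 <= M) by (unfold M; pose proof (Rabs_pos (g a)); lra).
assert (HM : forall t, a <= t <= b -> Rabs (g t) <= M).
{ intros t Ht; unfold M.
  assert (H1 := HV a t (Rle_refl a) (proj1 Ht) (proj2 Ht)).
  assert (H2 := HV t b (proj1 Ht) (proj2 Ht) (Rle_refl b)).
  pose proof (Rabs_pos (g b - g t)).
  pose proof (Rabs_triang (g a) (g t - g a)) as T.
  replace (g a + (g t - g a)) with (g t) in T by ring; lra. }
apply filterlim_locally; intros eps.
set (N := M * (b - a) + (V b - V a)).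
assert (N0 : 0 <= N) by (unfold N; nra).
set (e := eps / 2 / (N + 1)).
assert (He : 0 < e)
  by (apply Rdiv_lt_0_compat; [pose proof (cond_pos eps)|]; lra).
destruct (uniform_modulus C a b e CC He) as [d1 [Hd1 Hm1]].
destruct (uniform_modulus Psi a b e CPsi He) as [d2 [Hd2 Hm2]].
set (d := Rmin d1 d2 / 2).
assert (Hd : 0 < d /\ d < d1 /\ d < d2).
{ unfold d; pose proof (Rmin_l d1 d2); pose proof (Rmin_r d1 d2).
  pose proof (Rmin_glb_lt d1 d2 0 Hd1 Hd2); lra. }
assert (Q1 := Riemann_fine_cells a b d (Rlt_le _ _ Hab) (proj1 Hd)).
assert (Q2 := is_RSInt_elim _ _ _ _ _ (eps / 2) Hab HL
                ltac:(pose proof (cond_pos eps); lra)).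
apply filter_imp with (2 := filter_and _ _ Q1 Q2); clear Q1 Q2.
intros p [[Ea Fp] Q].
rewrite sign_eq_1, Riemann_sum_cells by lra; rewrite Ea in Q |- *.
set (D := fun u v t => (v - u) * (g t * C t)
        - (g v * Psi v - g u * Psi u) + (g v - g u) * Psi t).
(* each cell contributes at most e times an increment of M * x + V x *)
assert (B : Rabs (cell_sum D a (SF_t p))
  <= e * (M * b + V b) - e * (M * a + V a)).
{ apply (cell_sum_bound D (fun x => e * (M * x + V x)) a b d); [|exact Fp].
  intros u v t Hu Ht Hv Huv; unfold D.
  destruct (mean_value Psi C u v DPsi) as [c [Hc Ec]].
  rewrite Rmin_left, Rmax_right in Hc by lra.
  replace ((v - u) * (g t * C t) - (g v * Psi v - g u * Psi u) + (g v - g u) * Psi t)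
    with (g t * ((v - u) * C t - (Psi v - Psi u))
          - (g v - g t) * (Psi v - Psi t) - (g t - g u) * (Psi u - Psi t)) by ring.
  rewrite Ec.
  replace ((v - u) * C t - C c * (v - u)) with ((v - u) * (C t - C c)) by ring.
  assert (B1 : Rabs (C t - C c) < e) by (apply Hm1; try lra; apply Rabs_def1; lra).
  assert (B2 : Rabs (Psi v - Psi t) < e) by (apply Hm2; try lra; apply Rabs_def1; lra).
  assert (B3 : Rabs (Psi u - Psi t) < e) by (apply Hm2; try lra; apply Rabs_def1; lra).
  assert (G1 := HV t v ltac:(lra) ltac:(lra) Hv).
  assert (G2 := HV u t Hu ltac:(lra) ltac:(lra)).
  assert (G3 := HM t ltac:(lra)).
  assert (P : forall x y X Y, Rabs x <= X -> Rabs y <= Y -> Rabs (x * y) <= X * Y).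
  { intros x y X Y Hx Hy; rewrite Rabs_mult.
    apply Rmult_le_compat; try apply Rabs_pos; assumption. }
  assert (T1 := P _ _ _ _ G3 (P (v - u) _ _ _
    (Req_le _ _ (Rabs_pos_eq (v - u) ltac:(lra))) (Rlt_le _ _ B1))).
  assert (T2 := P _ _ _ _ G1 (Rlt_le _ _ B2)).
  assert (T3 := P _ _ _ _ G2 (Rlt_le _ _ B3)).
  apply Rabs_le_between in T1, T2, T3; apply Rabs_le; lra. }
assert (E : cell_sum (fun u v t => (v - u) * (g t * C t)) a (SF_t p)
  = cell_sum D a (SF_t p) + (g b * Psi b - g a * Psi a)
    - cell_sum (fun u v t => (g v - g u) * Psi t) a (SF_t p)).
{ rewrite <- (cell_sum_telescope a b d (fun x => g x * Psi x) a (SF_t p) Fp).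
  rewrite (cell_sum_linear (-1)
    (fun u v t => D u v t + 1 * (g v * Psi v - g u * Psi u))
    (fun u v t => (g v - g u) * Psi t)) by (intros; unfold D; ring).
  rewrite (cell_sum_linear 1 D (fun u v _ => g v * Psi v - g u * Psi u))
    by reflexivity.
  ring. }
rewrite E.
set (S := cell_sum (fun u v t => (g v - g u) * Psi t) _ _) in *.
set (SD := cell_sum D _ _) in *.
change (Rabs (1 * (SD + (g b * Psi b - g a * Psi a) - S)
              - (g b * Psi b - g a * Psi a - L)) < eps).
replace (e * (M * b + V b) - e * (M * a + V a)) with (e * N) in B by (unfold N; ring).
assert (e * (N + 1) = eps / 2) by (unfold e; field; lra).
apply Rabs_le_between in B; apply Rabs_lt_between in Q.
apply Rabs_def1; lra.
Qed.

(** * Convolution with the measure of g *)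

Lemma continuous_convolved (F : R -> R) (x : R) :
  (forall t, continuous F t) -> forall y, continuous (fun y => F (x - y)) y.
Proof.
intros CF y; apply (continuous_ext (fun y => F (- 1 * y + x))).
- intros t; f_equal; ring.
- now apply continuous_affine.
Qed.

(** By [is_RSInt_bound], a small change of [x] matters only through the uniform
    norm of the change of [F (x - y)]. *)
Lemma continuous_RSInt_convolution (V F g : R -> R) (a b : R) :
  a < b -> var_dominated V g a b -> (forall x, continuous F x) ->
  forall x, continuous (fun x => RSInt (fun y => F (x - y)) g a b) x.
Proof.
intros Hab HV CF x.
assert (I : forall z, is_RSInt (fun y => F (z - y)) g a b
                        (RSInt (fun y => F (z - y)) g a b)).
{ intros z; apply is_RSInt_RSInt, (ex_RSInt_continuous V); trivial.
  now apply continuous_convolved. }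
assert (HVab := HV a b (Rle_refl a) (Rlt_le _ _ Hab) (Rle_refl b)).
assert (V0 : 0 <= V b - V a) by (pose proof (Rabs_pos (g b - g a)); lra).
apply filterlim_locally; intros eps.
set (e := eps / (V b - V a + 1)).
assert (He : 0 < e) by (apply Rdiv_lt_0_compat; [apply cond_pos|lra]).
destruct (uniform_modulus F (x - b - 1) (x - a + 1) e CF He) as [d [Hd Hm]].
exists (mkposreal (Rmin d 1) (Rmin_glb_lt _ _ _ Hd Rlt_0_1)); intros z Hz.
change (Rabs (z - x) < Rmin d 1) in Hz.
assert (Hz1 := Rlt_le_trans _ _ _ Hz (Rmin_l d 1)).
assert (Hz2 := Rlt_le_trans _ _ _ Hz (Rmin_r d 1)).
change (Rabs (RSInt (fun y => F (z - y)) g a b - RSInt (fun y => F (x - y)) g a b) < eps).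
assert (L := is_RSInt_linear (fun y => F (z - y)) (fun y => F (x - y))
  (fun y => F (z - y) - F (x - y)) g (- 1) a b _ _
  Hab ltac:(intros; cbv beta; ring) (I z) (I x)).
apply Rle_lt_trans with (e * (V b - V a)).
- replace (RSInt (fun y => F (z - y)) g a b - RSInt (fun y => F (x - y)) g a b)
    with (RSInt (fun y => F (z - y)) g a b + - 1 * RSInt (fun y => F (x - y)) g a b)
    by ring.
  apply (is_RSInt_bound V (fun y => F (z - y) - F (x - y)) g a b); trivial.
  intros y Hy; apply Rlt_le, Hm.
  + apply Rabs_def2 in Hz2; lra.
  + lra.
  + now replace (z - y - (x - y)) with (z - x) by ring.
- replace (pos eps) with (e * (V b - V a + 1)) by (unfold e; field; lra); nra.
Qed.

(** By the mean value theorem [Phi (x + h - y) - Phi (x - y) - h * F (x - y)] is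
    [o(h)] uniformly in [y], and the integral is continuous for the uniform
    norm. *)
Lemma is_derive_RSInt_convolution (V F Phi g : R -> R) (a b : R) :
  a < b -> var_dominated V g a b ->
  (forall x, continuous F x) -> (forall x, is_derive Phi x (F x)) ->
  forall x, is_derive (fun x => RSInt (fun y => Phi (x - y)) g a b) x
              (RSInt (fun y => F (x - y)) g a b).
Proof.
intros Hab HV CF DPhi x.
assert (CPhi : forall t, continuous Phi t)
  by (intros t; apply (ex_derive_continuous Phi t); exists (F t); apply DPhi).
assert (I : forall H : R -> R, (forall t, continuous H t) -> forall z,
  is_RSInt (fun y => H (z - y)) g a b (RSInt (fun y => H (z - y)) g a b)).
{ intros H CH z; apply is_RSInt_RSInt, (ex_RSInt_continuous V); trivial.
  now apply continuous_convolved. }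
assert (HVab := HV a b (Rle_refl a) (Rlt_le _ _ Hab) (Rle_refl b)).
assert (V0 : 0 <= V b - V a) by (pose proof (Rabs_pos (g b - g a)); lra).
apply is_derive_Reals; intros eps Heps.
set (e := eps / (V b - V a + 1)).
assert (He : 0 < e) by (apply Rdiv_lt_0_compat; lra).
destruct (uniform_modulus F (x - b - 1) (x - a + 1) e CF He) as [d [Hd Hm]].
exists (mkposreal (Rmin d 1) (Rmin_glb_lt _ _ _ Hd Rlt_0_1)); simpl; intros h Hh0 Hh.
assert (Hh1 := Rlt_le_trans _ _ _ Hh (Rmin_l d 1)).
assert (Hh2 := Rlt_le_trans _ _ _ Hh (Rmin_r d 1)).
assert (Hp : 0 < Rabs h) by now apply Rabs_pos_lt.
set (J := fun x => RSInt (fun y => Phi (x - y)) g a b).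
set (k := RSInt (fun y => F (x - y)) g a b).
assert (L1 := is_RSInt_linear (fun y => Phi (x + h - y)) (fun y => Phi (x - y))
  (fun y => Phi (x + h - y) - Phi (x - y)) g (- 1) a b
  _ _ Hab ltac:(intros; cbv beta; ring) (I Phi CPhi (x + h)) (I Phi CPhi x)).
assert (L2 := is_RSInt_linear
  (fun y => Phi (x + h - y) - Phi (x - y)) (fun y => F (x - y))
  (fun y => Phi (x + h - y) - Phi (x - y) - h * F (x - y)) g (- h) a b
  _ _ Hab ltac:(intros; cbv beta; ring) L1 (I F CF x)).
assert (B : Rabs (J (x + h) + - 1 * J x + - h * k) <= Rabs h * e * (V b - V a)).
{ apply (is_RSInt_bound V _ g a b _ _ Hab HV) with (2 := L2); intros y Hy.
  destruct (mean_value Phi F (x - y) (x + h - y) DPhi) as [c [Hc Ec]].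
  rewrite Ec.
  replace (F c * (x + h - y - (x - y)) - h * F (x - y))
    with (h * (F c - F (x - y))) by ring.
  rewrite Rabs_mult; apply Rmult_le_compat_l; [lra|].
  assert (Hcy : Rabs (c - (x - y)) <= Rabs h).
  { unfold Rmin, Rmax in Hc; destruct (Rle_dec (x - y) (x + h - y)).
    - rewrite !Rabs_pos_eq; lra.
    - rewrite !Rabs_left1; lra. }
  apply Rlt_le, Hm; try lra.
  apply Rle_lt_trans with (2 := Hh2), Rabs_def2 in Hcy; lra. }
change (Rabs ((J (x + h) - J x) / h - k) < eps).
replace ((J (x + h) - J x) / h - k) with ((J (x + h) + - 1 * J x + - h * k) / h)
  by (field; exact Hh0).
rewrite Rabs_div by exact Hh0; unfold Rdiv at 1.
apply (Rmult_lt_reg_r (Rabs h)); [exact Hp|].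
rewrite Rmult_assoc, Rinv_l, Rmult_1_r by lra.
apply Rle_lt_trans with (1 := B).
replace eps with (e * (V b - V a + 1)) by (unfold e; field; lra).
assert (0 < Rabs h * e) by now apply Rmult_lt_0_compat.
nra.
Qed.

(** * Smooth functions with compact support *)

(** For [x > 0] this is x^(-k) exp (- 1 / x).  Keeping all the powers of [1 / x]
    makes the family closed under differentiation, up to linear combinations. *)
Definition flat (k : nat) (x : R) : R :=
  if Rlt_dec 0 x then (/ x) ^ k * exp (- / x) else 0.

Lemma flat_pos (k : nat) (x : R) : 0 < x -> flat k x = (/ x) ^ k * exp (- / x).
Proof. unfold flat; intros H; destruct (Rlt_dec 0 x); lra. Qed.

Lemma flat_nonpos (k : nat) (x : R) : x <= 0 -> flat k x = 0.
Proof. unfold flat; intros H; destruct (Rlt_dec 0 x); lra. Qed.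

(** The power [n] of [u <= (n + 1) * exp (u / (n + 1))]; dividing by [n + 1]
    rather than [n] covers [n = 0]. *)
Lemma exp_lower (n : nat) (u : R) : 0 <= u -> u ^ n <= INR (S n) ^ n * exp u.
Proof.
intros Hu; assert (Hn : 0 < INR (S n)) by apply lt_0_INR, Nat.lt_0_succ.
apply Rle_trans with ((INR (S n) * exp (u / INR (S n))) ^ n).
- apply pow_incr; split; [exact Hu|].
  pose proof (exp_ineq1_le (u / INR (S n))) as E.
  replace u with (INR (S n) * (u / INR (S n))) at 1 by (field; lra); nra.
- rewrite Rpow_mult_distr; apply Rmult_le_compat_l; [apply pow_le; lra|].
  assert (E : forall m y, exp y ^ m = exp (INR m * y)).
  { intros m y; induction m as [|m IH]; [simpl; now rewrite Rmult_0_l, exp_0|].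
    rewrite S_INR; simpl pow; rewrite IH, <- exp_plus; f_equal; ring. }
  rewrite E.
  destruct (Rle_lt_or_eq_dec 0 u Hu) as [Hu'| <-].
  + apply Rlt_le, exp_increasing; rewrite S_INR in *.
    apply (Rmult_lt_reg_r (INR n + 1)); [lra|]; field_simplify; nra.
  + right; f_equal; unfold Rdiv; ring.
Qed.

Lemma flat_small (k : nat) (x : R) :
  0 < x -> 0 <= flat k x <= INR (S (S k)) ^ (S k) * x.
Proof.
intros Hx; rewrite flat_pos by exact Hx.
assert (Hi : 0 < / x) by now apply Rinv_0_lt_compat.
assert (Hk : 0 < (/ x) ^ k) by now apply pow_lt.
assert (E := exp_lower (S k) (/ x) (Rlt_le _ _ Hi)).
assert (P := exp_pos (- / x)).
assert (Q : exp (/ x) * exp (- / x) = 1) by (rewrite <- exp_plus, Rplus_opp_r; apply exp_0).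
set (N := INR (S (S k)) ^ S k) in *; simpl in E.
split; [nra|].
replace ((/ x) ^ k * exp (- / x)) with (x * ((/ x * (/ x) ^ k) * exp (- / x)))
  by (field; lra).
replace (N * x) with (x * (N * exp (/ x) * exp (- / x)))
  by (rewrite Rmult_assoc, Q; ring).
apply Rmult_le_compat_l; [lra|]; apply Rmult_le_compat_r; lra.
Qed.

(** At the origin, the difference quotient of [flat k] is [flat (k + 1)] on the
    right and zero on the left. *)
Lemma is_derive_flat (k : nat) (x : R) :
  is_derive (flat k) x (flat (k + 2) x - INR k * flat (k + 1) x).
Proof.
destruct (Rtotal_order x 0) as [Hx|[->|Hx]].
- rewrite !flat_nonpos by lra.
  apply (is_derive_ext_loc (fun _ => 0)).
  + exists (mkposreal (- x) ltac:(lra)); intros y Hy.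
    apply Rabs_def2 in Hy; simpl in Hy; unfold minus, plus, opp in Hy; simpl in Hy.
    symmetry; apply flat_nonpos; lra.
  + replace (0 - INR k * 0) with 0 by ring; apply (is_derive_const (V := R_NormedModule)).
- rewrite !flat_nonpos by lra; replace (0 - INR k * 0) with 0 by ring.
  apply is_derive_Reals; intros eps He.
  set (N := INR (S (S (k + 1))) ^ S (k + 1)).
  assert (HN : 0 < N) by apply pow_lt, lt_0_INR, Nat.lt_0_succ.
  exists (mkposreal (eps / N) (Rdiv_lt_0_compat _ _ He HN)); simpl; intros h Hh0 Hh.
  rewrite Rplus_0_l, (flat_nonpos k 0), !Rminus_0_r by lra.
  destruct (Rle_dec h 0) as [Hn|Hn].
  + rewrite flat_nonpos by exact Hn; unfold Rdiv; rewrite Rmult_0_l, Rabs_R0; exact He.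
  + assert (Hp : 0 < h) by lra.
    replace (flat k h / h) with (flat (k + 1) h)
      by (rewrite !flat_pos, pow_add by exact Hp; field; lra).
    destruct (flat_small (k + 1) h Hp) as [B1 B2]; fold N in B2.
    rewrite Rabs_pos_eq in Hh |- * by lra.
    apply Rle_lt_trans with (1 := B2).
    replace eps with (N * (eps / N)) by (field; lra); now apply Rmult_lt_compat_l.
- rewrite !flat_pos by lra.
  apply (is_derive_ext_loc (fun y => (/ y) ^ k * exp (- / y))).
  + exists (mkposreal x Hx); intros y Hy.
    apply Rabs_def2 in Hy; simpl in Hy; unfold minus, plus, opp in Hy; simpl in Hy.
    symmetry; apply flat_pos; lra.
  + auto_derive; [lra|].
    destruct k as [|k]; [simpl; field; lra|].
    rewrite !pow_add; change (Init.Nat.pred (S k)) with k; simpl pow; field; lra.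
Qed.

(** A class of functions in which every member has a derivative that is again in
    the class; its members are therefore smooth, with no formula for their
    higher derivatives.  Closing it under primitives makes the primitive of a bump
    function smooth at once. *)
Inductive flat_algebra : (R -> R) -> Prop :=
| fa_const c : flat_algebra (fun _ => c)
| fa_flat k : flat_algebra (flat k)
| fa_affine s c f : flat_algebra f -> flat_algebra (fun x => f (s * x + c))
| fa_plus f g : flat_algebra f -> flat_algebra g -> flat_algebra (fun x => f x + g x)
| fa_mult f g : flat_algebra f -> flat_algebra g -> flat_algebra (fun x => f x * g x)
| fa_primitive f g : (forall x, is_derive f x (g x)) -> flat_algebra g -> flat_algebra f.

Lemma flat_algebra_derive (f : R -> R) :
  flat_algebra f -> exists g, flat_algebra g /\ forall x, is_derive f x (g x).
Proof.
induction 1 as [c|k|s c f Hf [f' [Hf' Df]]|f g Hf [f' [Hf' Df]] Hg [g' [Hg' Dg]]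
               |f g Hf [f' [Hf' Df]] Hg [g' [Hg' Dg]]|f g Df Hg _].
- exists (fun _ => 0); split; [constructor|intros x].
  apply (is_derive_const (V := R_NormedModule)).
- exists (fun x => flat (k + 2) x + - INR k * flat (k + 1) x); split.
  + apply fa_plus; [|apply fa_mult]; constructor.
  + intros x.
    replace (flat (k + 2) x + - INR k * flat (k + 1) x)
      with (flat (k + 2) x - INR k * flat (k + 1) x) by ring.
    apply is_derive_flat.
- exists (fun x => s * f' (s * x + c)); split.
  + apply fa_mult; [constructor|now apply fa_affine].
  + intros x; apply (is_derive_comp f (fun x => s * x + c)); [apply Df|].
    auto_derive; [trivial|].
    match goal with |- @eq _ ?u ?v => change (@eq R u v) end; ring.
- exists (fun x => f' x + g' x); split; [now constructor|].
  intros x; apply (is_derive_plus f g x); auto.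
- exists (fun x => f' x * g x + f x * g' x); split.
  + now apply fa_plus; apply fa_mult.
  + intros x; apply (is_derive_mult f g x); auto; intros; apply Rmult_comm.
- now exists g.
Qed.

Lemma flat_algebra_smooth (f : R -> R) :
  flat_algebra f -> forall n x, ex_derive_n f n x.
Proof.
intros Hf.
assert (D : forall n, exists g, flat_algebra g /\ forall x, Derive_n f n x = g x).
{ induction n as [|n [g [Hg E]]]; [now exists f|].
  destruct (flat_algebra_derive g Hg) as [g' [Hg' Dg]]; exists g'; split; [exact Hg'|].
  intros x; simpl; rewrite (Derive_ext _ g) by exact E.
  apply is_derive_unique, Dg. }
intros [|n] x; [exact I|]; destruct (D n) as [g [Hg E]]; simpl.
apply (ex_derive_ext g); [intros; now rewrite E|].
destruct (flat_algebra_derive g Hg) as [g' [_ Dg]]; exists (g' x); apply Dg.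
Qed.

Lemma flat_algebra_continuous (f : R -> R) :
  flat_algebra f -> forall x, continuous f x.
Proof.
intros Hf x; apply (ex_derive_continuous f x).
exact (flat_algebra_smooth f Hf 1 x).
Qed.

Definition bump (w x : R) : R := flat 0 x * flat 0 (- 1 * x + w).

Lemma bump_algebra (w : R) : flat_algebra (bump w).
Proof. apply fa_mult; [|apply (fa_affine _ _ (flat 0))]; constructor. Qed.

Lemma bump_continuous (w x : R) : continuous (bump w) x.
Proof. apply flat_algebra_continuous, bump_algebra. Qed.

Lemma bump_pos (w x : R) : 0 < x < w -> 0 < bump w x.
Proof.
intros H; unfold bump; rewrite !flat_pos by lra; simpl.
apply Rmult_lt_0_compat; rewrite Rmult_1_l; apply exp_pos.
Qed.

Lemma bump_out (w x : R) : x <= 0 \/ w <= x -> bump w x = 0.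
Proof.
unfold bump; intros [H|H];
  [rewrite (flat_nonpos 0 x)|rewrite (flat_nonpos 0 (- 1 * x + w))];
  try lra; ring.
Qed.

(** * Uniqueness of the primitive *)

Lemma RInt_null (h : R -> R) (u v : R) :
  u <= v -> (forall x, u < x < v -> h x = 0) -> RInt h u v = 0.
Proof.
intros Huv Hh; rewrite (RInt_ext h (fun _ => 0)).
- rewrite RInt_const; apply Rmult_0_r.
- intros x; rewrite Rmin_left, Rmax_right by exact Huv; apply Hh.
Qed.

Lemma RInt_bump_shift (H : R -> R) (w a A B : R) :
  0 < w -> (forall x, continuous H x) -> A <= a -> a + w <= B ->
  RInt (fun x => H x * bump w (1 * x + - a)) A B
  = RInt (fun u => H (1 * u + a) * bump w u) 0 w.
Proof.
intros Hw CH HA HB.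
set (h := fun x => H x * bump w (1 * x + - a)).
assert (Ch : forall x, continuous h x).
{ intros x; apply (continuous_mult H (fun x => bump w (1 * x + - a))); [apply CH|].
  apply continuous_affine, bump_continuous. }
assert (exh : forall u v, ex_RInt h u v)
  by (intros u v; apply (ex_RInt_continuous h); intros; apply Ch).
rewrite <- (RInt_Chasles h A a B), <- (RInt_Chasles h a (a + w) B) by apply exh.
rewrite (RInt_null h A a), (RInt_null h (a + w) B); try lra.
2, 3: intros x Hx; unfold h; rewrite bump_out by lra; ring.
replace a with (1 * 0 + a) at 1 by ring; replace (a + w) with (1 * w + a) by ring.
rewrite <- (RInt_comp_lin h 1 a 0 w) by apply exh.
transitivity (RInt (fun y => scal 1 (h (1 * y + a))) 0 w).
- match goal with |- @eq _ (plus _ (plus ?u _)) _ => change (0 + (u + 0) = u) end; ring.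
- apply RInt_ext; intros x _; unfold h.
  replace (1 * (1 * x + a) + - a) with x by ring.
  change (1 * (H (1 * x + a) * bump w x) = H (1 * x + a) * bump w x); ring.
Qed.

Definition bump_primitive (w x : R) : R := RInt (bump w) 0 x.

Lemma is_derive_bump_primitive (w x : R) :
  is_derive (bump_primitive w) x (bump w x).
Proof.
apply (is_derive_RInt (bump w) (bump_primitive w) 0 x); [|apply bump_continuous].
apply filter_forall; intros y; apply (RInt_correct (bump w) 0 y).
apply (ex_RInt_continuous (bump w)); intros; apply bump_continuous.
Qed.

Lemma bump_primitive_left (w x : R) : x <= 0 -> bump_primitive w x = 0.
Proof.
intros Hx; unfold bump_primitive.
rewrite <- (opp_RInt_swap (bump w)).
- rewrite RInt_null; [exact Ropp_0|exact Hx|].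
  intros y Hy; apply bump_out; lra.
- apply (ex_RInt_continuous (bump w)); intros; apply bump_continuous.
Qed.

Lemma bump_primitive_right (w x : R) :
  w <= x -> bump_primitive w x = bump_primitive w w.
Proof.
intros Hx; unfold bump_primitive.
rewrite <- (RInt_Chasles (bump w) 0 w x)
  by (apply (ex_RInt_continuous (bump w)); intros; apply bump_continuous).
rewrite (RInt_null (bump w) w x); [apply Rplus_0_r|exact Hx|].
intros y Hy; apply bump_out; lra.
Qed.

(** The difference of two translates of the same primitive: it vanishes where both
    are zero and where both have reached their final value, so its support is
    compact, and its derivative is a difference of two bumps. *)
Definition plateau (w a c x : R) : R :=
  bump_primitive w (1 * x + - a) + - 1 * bump_primitive w (1 * x + - c).

Lemma is_derive_plateau (w a c x : R) :
  is_derive (plateau w a c) x (bump w (1 * x + - a) - bump w (1 * x + - c)).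
Proof.
assert (D : forall b, is_derive (fun x => bump_primitive w (1 * x + - b)) x
                        (bump w (1 * x + - b))).
{ intros b; replace (bump w (1 * x + - b)) with (1 * bump w (1 * x + - b)) by ring.
  apply (is_derive_comp (bump_primitive w) (fun x => 1 * x + - b)).
  - apply is_derive_bump_primitive.
  - auto_derive; [trivial|].
    match goal with |- @eq _ ?u ?v => change (@eq R u v) end; ring. }
replace (bump w (1 * x + - a) - bump w (1 * x + - c))
  with (bump w (1 * x + - a) + - 1 * bump w (1 * x + - c)) by ring.
apply (is_derive_plus (fun x => bump_primitive w (1 * x + - a))); [apply D|].
apply (is_derive_scal (fun x => bump_primitive w (1 * x + - c)) x (- 1)), D.
Qed.

Lemma plateau_smooth (w a c : R) (n : nat) (x : R) :
  ex_derive_n (plateau w a c) n x.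
Proof.
apply flat_algebra_smooth.
assert (P : flat_algebra (bump_primitive w)).
{ apply (fa_primitive _ (bump w)); [apply is_derive_bump_primitive|apply bump_algebra]. }
apply fa_plus; [now apply fa_affine|].
apply (fa_mult (fun _ => - 1)); [constructor|now apply fa_affine].
Qed.

Lemma plateau_supp (w a c : R) :
  exists M, forall x, M < Rabs x -> plateau w a c x = 0.
Proof.
exists (Rabs a + Rabs c + Rabs w); intros x Hx; unfold plateau.
pose proof (Rle_abs a); pose proof (Rle_abs c); pose proof (Rle_abs w).
pose proof (Rle_abs (- a)); pose proof (Rle_abs (- c)); pose proof (Rle_abs (- w)).
rewrite !Rabs_Ropp in *.
destruct (Rle_dec 0 x) as [Hx0|Hx0].
- rewrite (Rabs_pos_eq x) in Hx by exact Hx0.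
  rewrite (bump_primitive_right w (1 * x + - a)), (bump_primitive_right w (1 * x + - c))
    by lra; ring.
- rewrite (Rabs_left x) in Hx by lra.
  rewrite !bump_primitive_left by lra; ring.
Qed.

Definition plateau_test (w a c : R) : test_fun :=
  TestFun (plateau w a c) (plateau_smooth w a c) (plateau_supp w a c).

(** Tested on a plateau, a distribution returns an average of the increments of
    its primitive over translates of the interval [a, c]. *)
Lemma dist_derive_plateau (F : R -> R) (f : distribution) (w a c : R) :
  0 < w -> (forall x, continuous F x) -> is_dist_derive F f ->
  f (plateau_test w a c)
  = RInt (fun u => (F (1 * u + c) - F (1 * u + a)) * bump w u) 0 w.
Proof.
intros Hw CF HF; rewrite (HF (plateau_test w a c)).
destruct (pairing_RInt F (plateau_test w a c) CF) as [M [M0 [_ E]]].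
set (A := - (M + Rabs a + Rabs c)); set (B := M + Rabs a + Rabs c + w).
pose proof (Rle_abs a); pose proof (Rle_abs c).
pose proof (Rle_abs (- a)); pose proof (Rle_abs (- c)); rewrite !Rabs_Ropp in *.
pose proof (Rabs_pos a); pose proof (Rabs_pos c).
rewrite (E A B) by (unfold A, B; lra).
assert (exb : forall b, ex_RInt (fun x => F x * bump w (1 * x + - b)) A B).
{ intros b; apply (ex_RInt_continuous (fun x => F x * bump w (1 * x + - b))).
  intros x _; apply (continuous_mult F (fun x => bump w (1 * x + - b))); [apply CF|].
  apply continuous_affine, bump_continuous. }
assert (exs : forall b, ex_RInt (fun u => F (1 * u + b) * bump w u) 0 w).
{ intros b; apply (ex_RInt_continuous (fun u => F (1 * u + b) * bump w u)).
  intros x _; apply (continuous_mult (fun u => F (1 * u + b)) (bump w)).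
  - now apply continuous_affine.
  - apply bump_continuous. }
rewrite (RInt_ext _ (fun x => minus (F x * bump w (1 * x + - a))
                                    (F x * bump w (1 * x + - c)))).
2: { intros x _; rewrite (is_derive_unique (plateau_test w a c) x _ (is_derive_plateau w a c x)).
     unfold minus, plus, opp; simpl; ring. }
rewrite (RInt_minus (fun x => F x * bump w (1 * x + - a))) by apply exb.
rewrite !RInt_bump_shift by (trivial; unfold A, B; lra).
rewrite (RInt_ext (fun u => (F (1 * u + c) - F (1 * u + a)) * bump w u)
  (fun u => minus (F (1 * u + c) * bump w u) (F (1 * u + a) * bump w u))).
2: { intros x _; unfold minus, plus, opp; simpl; ring. }
rewrite (RInt_minus (fun u => F (1 * u + c) * bump w u)) by apply exs.
unfold minus, plus, opp; simpl; ring.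
Qed.

(** Otherwise the averages of the two increments would differ as soon as the
    averaging window is so small that the increment of [F] exceeds that of [G]
    all along it. *)
Lemma dist_primitives_increment_le (F G : R -> R) (f : distribution) (a c : R) :
  (forall x, continuous F x) -> (forall x, continuous G x) ->
  is_dist_derive F f -> is_dist_derive G f ->
  F c - F a <= G c - G a.
Proof.
intros CF CG HF HG; apply Rnot_lt_le; intros Hlt.
set (D := fun u => (F (1 * u + c) - F (1 * u + a)) - (G (1 * u + c) - G (1 * u + a))).
assert (CD : forall u, continuous D u).
{ intros u; apply (continuous_minus (fun u => F (1 * u + c) - F (1 * u + a))
                     (fun u => G (1 * u + c) - G (1 * u + a))).
  - apply (continuous_minus (fun u => F (1 * u + c)) (fun u => F (1 * u + a)));
      now apply continuous_affine.
  - apply (continuous_minus (fun u => G (1 * u + c)) (fun u => G (1 * u + a)));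
      now apply continuous_affine. }
assert (D0 : 0 < D 0) by (unfold D; rewrite Rmult_0_r, !Rplus_0_l; lra).
destruct (uniform_modulus D 0 1 (D 0) CD D0) as [d [Hd Hm]].
set (w := Rmin d 1 / 2).
assert (Hw : 0 < w /\ w < d /\ w < 1).
{ unfold w; pose proof (Rmin_l d 1); pose proof (Rmin_r d 1).
  pose proof (Rmin_glb_lt d 1 0 Hd Rlt_0_1); lra. }
assert (P : 0 < RInt (fun u => D u * bump w u) 0 w).
{ apply RInt_gt_0; [lra| |].
  - intros u Hu; apply Rmult_lt_0_compat; [|now apply bump_pos].
    assert (K := Hm 0 u ltac:(lra) ltac:(lra) ltac:(apply Rabs_def1; lra)).
    apply Rabs_def2 in K; lra.
  - intros u _; apply (continuous_mult D (bump w)); [apply CD|apply bump_continuous]. }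
assert (ex : forall H : R -> R, (forall x, continuous H x) ->
  ex_RInt (fun u => (H (1 * u + c) - H (1 * u + a)) * bump w u) 0 w).
{ intros H CH.
  apply (ex_RInt_continuous (fun u => (H (1 * u + c) - H (1 * u + a)) * bump w u)).
  intros x _; apply (continuous_mult (fun u => H (1 * u + c) - H (1 * u + a)) (bump w));
    [|apply bump_continuous].
  apply (continuous_minus (fun u => H (1 * u + c)) (fun u => H (1 * u + a)));
      now apply continuous_affine. }
rewrite (RInt_ext _ (fun u => minus ((F (1 * u + c) - F (1 * u + a)) * bump w u)
                                    ((G (1 * u + c) - G (1 * u + a)) * bump w u))) in P.
2: { intros u _; unfold D, minus, plus, opp; simpl; ring. }
rewrite (RInt_minus (fun u => (F (1 * u + c) - F (1 * u + a)) * bump w u)) in P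
  by now apply ex.
rewrite <- (dist_derive_plateau F f), <- (dist_derive_plateau G f) in P by tauto.
unfold minus, plus, opp in P; simpl in P; lra.
Qed.

Lemma is_primitive_unique (F G : R -> R) (f : distribution) :
  is_primitive F f -> is_primitive G f -> F = G.
Proof.
intros [[CF [F0 _]] HF] [[CG [G0 _]] HG].
apply functional_extensionality; intros x.
pose proof (dist_primitives_increment_le F G f (- PI) x CF CG HF HG).
pose proof (dist_primitives_increment_le G F f (- PI) x CG CF HG HF).
lra.
Qed.

Lemma dist_primitive_unique (F : R -> R) (f : distribution) :
  is_primitive F f -> dist_primitive f = F.
Proof.
intros HF; apply (is_primitive_unique _ _ f); [|exact HF].
apply (epsilon_spec (inhabits (fun _ => 0)) (fun F => is_primitive F f)).
now exists F.
Qed.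

(** * The two iterated integrals *)

(** The constant [F (x + PI)] in the primitive of the reflected distribution
    contributes nothing to the Stieltjes integral, because [g] has the same
    value at both ends. *)
Lemma prod_int_reflect (V F g : R -> R) (f : distribution) (x : R) :
  is_primitive F f -> var_dominated V g (- PI) PI -> g (- PI) = g PI ->
  ex_RSInt (dist_primitive (dist_reflect x f)) g (- PI) PI /\
  prod_int (dist_reflect x f) g
  = (F (x + PI) - F (x - PI)) * g PI + RSInt (fun y => F (x - y)) g (- PI) PI.
Proof.
intros HF HV Hg; pose proof PI_RGT_0 as HPI.
assert (CF := proj1 (proj1 HF)).
assert (I : is_RSInt (fun y => F (x - y)) g (- PI) PI
              (RSInt (fun y => F (x - y)) g (- PI) PI)).
{ apply is_RSInt_RSInt, (ex_RSInt_continuous V); [lra|exact HV|].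
  now apply continuous_convolved. }
unfold prod_int.
rewrite (dist_primitive_unique _ _ (is_primitive_reflect F x f HF)).
assert (L := is_RSInt_linear (fun _ => F (x + PI)) (fun y => F (x - y))
  (fun y => - F (x - y) + F (x + PI)) g (- 1) (- PI) PI _ _
  ltac:(lra) ltac:(intros; cbv beta; ring)
  (is_RSInt_const (F (x + PI)) g (- PI) PI ltac:(lra)) I).
split; [now exists (F (x + PI) * (g PI - g (- PI))
                    + - 1 * RSInt (fun y => F (x - y)) g (- PI) PI)|].
rewrite (RSInt_unique _ _ _ _ _ L), Hg; ring.
Qed.

Lemma cp_int_translate (F : R -> R) (f : distribution) (k y a b : R) :
  is_primitive F f ->
  cp_int (dist_scale k (dist_translate y f)) a b = k * (F (b - y) - F (a - y)).
Proof.
intros HF; unfold cp_int.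
rewrite (dist_primitive_unique _ _
  (is_primitive_scale _ k _ (is_primitive_translate F y f HF))); ring.
Qed.

Theorem theorem21 :
  forall (f : distribution) (g : R -> R) (a b : R),
    AcT f -> BVT g -> a < b ->
    (* the integrals on both sides exist *)
    (forall x : R, a <= x <= b ->
       ex_RSInt (dist_primitive (dist_reflect x f)) g (- PI) PI) /\
    ex_RInt (fun x => prod_int (dist_reflect x f) g) a b /\
    ex_RInt (fun y => cp_int (dist_scale (g y) (dist_translate y f)) a b) (- PI) PI /\
    (* and they are equal *)
    RInt (fun x => prod_int (dist_reflect x f) g) a b
      = RInt (fun y => cp_int (dist_scale (g y) (dist_translate y f)) a b) (- PI) PI.
Proof.
intros f g a b [F HF] [Pg BVg] Hab; pose proof PI_RGT_0 as HPI.
assert (Hpi : - PI < PI) by lra.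
destruct (finite_variation_dominated g (- PI) PI BVg) as [V HV].
assert (Hg : g (- PI) = g PI) by (rewrite <- (Pg (- PI)); f_equal; ring).
assert (CF := proj1 (proj1 HF)).
set (Phi := fun x => RInt F 0 x).
assert (DPhi : forall x, is_derive Phi x (F x)).
{ intros x; apply (is_derive_RInt F Phi 0 x); [|apply CF].
  apply filter_forall; intros y; apply (RInt_correct F 0 y).
  apply (ex_RInt_continuous F); intros; apply CF. }
assert (CPhi : forall x, continuous Phi x)
  by (intros x; apply (ex_derive_continuous Phi x); exists (F x); apply DPhi).
set (K := fun x => RSInt (fun y => Phi (x - y)) g (- PI) PI).
set (k := fun x => RSInt (fun y => F (x - y)) g (- PI) PI).
assert (DK : forall x, is_derive K x (k x))
  by now apply (is_derive_RSInt_convolution V).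
assert (Ck : forall x, continuous k x)
  by now apply (continuous_RSInt_convolution V).
assert (Dshift : forall s x, is_derive (fun x => Phi (x + s)) x (F (x + s))).
{ intros s x; replace (F (x + s)) with (1 * F (x + s)) by ring.
  apply (is_derive_comp Phi (fun x => x + s)); [apply DPhi|].
  auto_derive; [trivial|].
  match goal with |- @eq _ ?u ?v => change (@eq R u v) end; ring. }
assert (Drefl : forall s y, is_derive (fun y => Phi (s - y)) y (- F (s - y))).
{ intros s y; replace (- F (s - y)) with (- 1 * F (s - y)) by ring.
  apply (is_derive_comp Phi (fun y => s - y)); [apply DPhi|].
  auto_derive; [trivial|].
  match goal with |- @eq _ ?u ?v => change (@eq R u v) end; ring. }
set (P := fun x => (Phi (x + PI) - Phi (x + - PI)) * g PI + K x).
assert (IL : is_RInt (fun x => prod_int (dist_reflect x f) g) a b (P b - P a)).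
{ apply (is_RInt_ext (fun x => (F (x + PI) - F (x + - PI)) * g PI + k x)).
  { intros x _; symmetry; now apply (prod_int_reflect V). }
  apply (is_RInt_derive P).
  - intros x _.
    apply (is_derive_plus (fun x => (Phi (x + PI) - Phi (x + - PI)) * g PI) K);
      [|apply DK].
    rewrite Rmult_comm.
    apply (is_derive_ext (fun x => g PI * (Phi (x + PI) - Phi (x + - PI))));
      [intros; apply Rmult_comm|].
    apply (is_derive_scal (fun x => Phi (x + PI) - Phi (x + - PI))).
    apply (is_derive_minus (fun x => Phi (x + PI)) (fun x => Phi (x + - PI)));
      apply Dshift.
  - intros x _.
    apply (continuous_plus (fun x => (F (x + PI) - F (x + - PI)) * g PI) k);
      [|apply Ck].
    apply (continuous_mult (fun x => F (x + PI) - F (x + - PI)) (fun _ => g PI));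
      [|apply continuous_const].
    apply (continuous_ext (fun x => F (1 * x + PI) - F (1 * x + - PI)));
      [intros; now rewrite Rmult_1_l|].
    apply (continuous_minus (fun x => F (1 * x + PI)) (fun x => F (1 * x + - PI)));
      now apply continuous_affine. }
assert (IR : is_RInt (fun y => cp_int (dist_scale (g y) (dist_translate y f)) a b)
               (- PI) PI (P b - P a)).
{ apply (is_RInt_ext (fun y => g y * (F (b - y) - F (a - y)))).
  { intros y _; symmetry; now apply cp_int_translate. }
  assert (I : forall z, is_RSInt (fun y => Phi (z - y)) g (- PI) PI (K z)).
  { intros z; apply is_RSInt_RSInt, (ex_RSInt_continuous V); trivial.
    now apply continuous_convolved. }
  assert (L := is_RSInt_linear (fun y => Phi (a - y)) (fun y => Phi (b - y))
    (fun y => Phi (a - y) - Phi (b - y)) g (- 1) (- PI) PI _ _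
    Hpi ltac:(intros; cbv beta; ring) (I a) (I b)).
  replace (P b - P a)
    with (g PI * (Phi (a - PI) - Phi (b - PI))
          - g (- PI) * (Phi (a - - PI) - Phi (b - - PI)) - (K a + - 1 * K b)).
  - apply (is_RInt_by_parts V g (fun y => Phi (a - y) - Phi (b - y))); trivial.
    + intros y.
      replace (F (b - y) - F (a - y)) with (- F (a - y) - - F (b - y)) by ring.
      apply (is_derive_minus (fun y => Phi (a - y)) (fun y => Phi (b - y)));
        apply Drefl.
    + intros y; apply (continuous_minus (fun y => F (b - y)) (fun y => F (a - y)));
        now apply continuous_convolved.
  - rewrite Hg; unfold P, Rminus; rewrite !Ropp_involutive; ring. }
split; [|split; [|split]].
- intros x _; now apply (prod_int_reflect V F).
- now exists (P b - P a).
- now exists (P b - P a).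
- now rewrite (is_RInt_unique _ _ _ _ IL), (is_RInt_unique _ _ _ _ IR).
Qed.
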